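(* Let $n\ge 2$ be an integer. The map $S\mapsto M^*SM$ is a Lie algebra isomorphism from $\mathfrak s(n,\mathbb R)$ onto $\mathfrak a$. Explicitly, every $S\in\mathfrak s(n,\mathbb R)$ can be written as $S=\beta_0Z+\sum_{i=1}^{n-1}\beta_iR_i+A$ with $\beta_0,\ldots,\beta_{n-1}\in\mathbb R$ and $A\in\mathfrak l$, and then $$M^*SM=\begin{pmatrix}0&\beta^*\\0&M_1^*AM_1+\frac{\beta_0}{\sqrt{n-1}}\,\mathrm{Id}\end{pmatrix},\qquad \beta^*=(\beta_1,\ldots,\beta_{n-1}).$$ In particular, the radical of $\mathfrak a$ is the space of matrices $$\begin{pmatrix}0&\beta^*\\0&\beta_0\,\mathrm{Id}\end{pmatrix},\qquad \beta_0,\beta_1,\ldots,\beta_{n-1}\in\mathbb R,$$ and the subalgebra of matrices $$\begin{pmatrix}0&0\\0&A\end{pmatrix},\qquad A\in\mathfrak{sl}(n-1,\mathbb R),$$ is a Levi subalgebra of $\mathfrak a$.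
   Context: $\mathfrak s(n,\mathbb R)=\{A\in\mathbb R^{n\times n}: A\mathbf 1=0\}$, where $\mathbf 1\in\mathbb R^n$ is the vector with all entries $1$, with bracket the matrix commutator. $\mathfrak a$ is the Lie algebra, under the matrix commutator, of all $n\times n$ real matrices of the block form $\begin{pmatrix}0&B\\0&A\end{pmatrix}$ with $B$ a row vector of length $n-1$ and $A\in\mathbb R^{(n-1)\times(n-1)}$; it is the Lie algebra of the group of matrices $\begin{pmatrix}1&B\\0&A\end{pmatrix}$ with $A$ nonsingular, which is identified with the group of invertible affine maps $q\mapsto qA+B$ of the space of row vectors of length $n-1$. Fix an orthonormal basis $v_1,\ldots,v_{n-1}$ of the hyperplane $\{x\in\mathbb R^n: x_1+\cdots+x_n=0\}$ and set $v_0=\frac1{\sqrt n}(1,\ldots,1)\in\mathbb R^n$. For $a,b\in\mathbb R^n$, $a\otimes b$ denotes the $n\times n$ matrix $(a_ib_j)_{i,j}$. Set $Z=\frac1{\sqrt{n-1}}(I_n-v_0\otimes v_0)$, $R_i=v_0\otimes v_i$ for $i=1,\ldots,n-1$, and $\mathfrak l=\mathcal A\oplus\mathcal H$ where $$\mathcal A=\mathrm{span}\{v_i\otimes v_j: 1\le i,j\le n-1,\ i\neq j\},\qquad \mathcal H=\Big\{\sum_{\ell=1}^{n-1}\gamma_\ell\,(v_\ell\otimes v_\ell): \gamma_\ell\in\mathbb R,\ \sum_{\ell=1}^{n-1}\gamma_\ell=0\Big\}.$$ $M\in\mathbb R^{n\times n}$ is the (orthogonal) matrix with columns $v_0,v_1,\ldots,v_{n-1}$,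 and $M_1\in\mathbb R^{n\times(n-1)}$ is the matrix with columns $v_1,\ldots,v_{n-1}$. The superscript $^*$ denotes transpose. A Levi subalgebra is a semisimple subalgebra complementary to the radical (the zero algebra being counted as semisimple). *)

(* Defs.v *)
From HB Require Import structures.
From mathcomp Require Import all_boot all_order all_algebra.
From mathcomp Require Import reals.

Set Implicit Arguments.
Unset Strict Implicit.
Unset Printing Implicit Defensive.

Import Order.TTheory GRing.Theory Num.Theory.
Local Open Scope ring_scope.

(* Lie subalgebras of gl(n, F), as subspaces of 'M[F]_n. *)
Section LieTheory.
Variable F : fieldType.

Definition lie_br n (A B : 'M[F]_n) : 'M[F]_n := A *m B - B *m A.

Section Subspaces.
Variable n : nat.
Implicit Types L K I : {vspace 'M[F]_n}.

Definition is_lie_algebra L : Prop := {in L &, forall A B, lie_br A B \in L}.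

Definition is_lie_subalgebra K L : Prop := (K <= L)%VS /\ is_lie_algebra K.

Definition is_lie_ideal I L : Prop :=
  (I <= L)%VS /\ {in L & I, forall A B, lie_br A B \in I}.

(* [U, V], the span of all brackets; by bilinearity the brackets of basis
   elements suffice, see lie_prodP. *)
Definition lie_prod (U V : {vspace 'M[F]_n}) : {vspace 'M[F]_n} :=
  <<allpairs (@lie_br n) (vbasis U) (vbasis V)>>%VS.

Definition derived_series k L : {vspace 'M[F]_n} :=
  iter k (fun U => lie_prod U U) L.

Definition is_solvable L : Prop := exists k, derived_series k L = 0%VS.

Definition is_radical r L : Prop :=
  [/\ is_lie_ideal r L, is_solvable r
    & forall I, is_lie_ideal I L -> is_solvable I -> (I <= r)%VS].

(* The zero algebra is semisimple in this sense. *)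
Definition is_semisimple L : Prop := is_lie_algebra L /\ is_radical 0%VS L.

Definition is_levi_subalgebra K L : Prop :=
  [/\ is_lie_subalgebra K L, is_semisimple K
    & exists2 r, is_radical r L & (K + r = L)%VS /\ (K :&: r = 0)%VS].

Lemma memv_lie_prod (U V : {vspace 'M[F]_n}) :
  {in U & V, forall A B, lie_br A B \in lie_prod U V}.
Proof.
move=> A B /coord_vbasis-> /coord_vbasis->; rewrite /lie_br.
rewrite mulmx_suml mulmx_sumr -sumrB; apply: memv_suml => i _.
rewrite mulmx_sumr mulmx_suml -sumrB; apply: memv_suml => j _.
rewrite -!scalemxAl -!scalemxAr !scalerA [X in _ - X *: _]mulrC -scalerBr memvZ //.
apply: memv_span; apply/allpairsP.
by exists ((vbasis U)`_i, (vbasis V)`_j); rewrite !memt_nth.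
Qed.

Lemma lie_prodP (U V W : {vspace 'M[F]_n}) :
  reflect {in U & V, forall A B, lie_br A B \in W} (lie_prod U V <= W)%VS.
Proof.
apply: (iffP idP) => [sUVW A B AU BV | sUVW].
  by rewrite (subvP sUVW) ?memv_lie_prod.
apply/span_subvP=> _ /allpairsP[[A B] /= [AU BV ->]].
by rewrite sUVW ?vbasis_mem.
Qed.

End Subspaces.

Definition is_lie_isomorphism n p (L : {vspace 'M[F]_n}) (L' : {vspace 'M[F]_p})
    (f : 'M[F]_n -> 'M[F]_p) : Prop :=
  [/\ is_lie_algebra L /\ is_lie_algebra L',
      {in L, forall A, f A \in L'},
      forall c, {in L &, forall A B, f (c *: A + B) = c *: f A + f B},
      {in L &, forall A B, f (lie_br A B) = lie_br (f A) (f B)}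
    & {in L &, injective f} /\ {in L', forall B, exists2 A, A \in L & f A = B}].

Definition sl_space n : {vspace 'M[F]_n} :=
  lker (linfun (mxtrace : 'M[F]_n -> F^o)).

Lemma mem_sl_space n (A : 'M[F]_n) : (A \in sl_space n) = (\tr A == 0).
Proof. by rewrite memv_ker lfunE. Qed.

End LieTheory.

Section Spaces.
Variable R : realType.

Definition s_space n : {vspace 'M[R]_n} :=
  lker (linfun (mulmxr (const_mx 1 : 'cV[R]_n))).

Lemma mem_s_space n (A : 'M[R]_n) :
  (A \in s_space n) = (A *m (const_mx 1 : 'cV[R]_n) == 0).
Proof. by rewrite memv_ker lfunE. Qed.

Definition hyperplane n : {vspace 'cV[R]_n} :=
  lker (linfun (mulmx (const_mx 1 : 'rV[R]_n))).

Lemma mem_hyperplane n (x : 'cV[R]_n) :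
  (x \in hyperplane n) = (\sum_i x i 0 == 0).
Proof.
rewrite memv_ker lfunE /=.
have -> : (const_mx 1 : 'rV[R]_n) *m x = (\sum_i x i 0)%:M.
  apply/matrixP=> i j; rewrite !ord1 !mxE mulr1n.
  by apply: eq_bigr => k _; rewrite !mxE mul1r.
apply/eqP/eqP => [/matrixP/(_ 0 0)|->]; first by rewrite !mxE mulr1n.
exact: raddf0.
Qed.

(* From here on m is n - 1, and n x n matrices have type 'M_(1 + m). *)
Definition aff_mx m (x : 'rV[R]_m * 'M[R]_m) : 'M[R]_(1 + m) :=
  block_mx 0 x.1 0 x.2.

Fact aff_mx_is_linear m : linear (@aff_mx m).
Proof.
by move=> c x y; rewrite /aff_mx scale_block_mx add_block_mx !scaler0 !addr0.
Qed.
HB.instance Definition _ m :=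
  GRing.isLinear.Build R _ _ _ (@aff_mx m) (@aff_mx_is_linear m).

Definition aff_space m : {vspace 'M[R]_(1 + m)} := limg (linfun (@aff_mx m)).

Lemma mem_aff_space m (X : 'M[R]_(1 + m)) :
  reflect (exists B A, X = block_mx 0 B 0 A) (X \in aff_space m).
Proof.
apply: (iffP memv_imgP) => [[[B A] _ ->]|[B [A ->]]].
  by exists B, A; rewrite lfunE.
by exists (B, A); rewrite ?memvf // lfunE.
Qed.

Definition aff_rad_mx m (x : 'cV[R]_m * R^o) : 'M[R]_(1 + m) :=
  block_mx 0 x.1^T 0 x.2%:M.

Fact aff_rad_mx_is_linear m : linear (@aff_rad_mx m).
Proof.
move=> c x y; rewrite /aff_rad_mx scale_block_mx add_block_mx !scaler0 !addr0.
by rewrite linearP /= raddfD /= scale_scalar_mx.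
Qed.
HB.instance Definition _ m :=
  GRing.isLinear.Build R _ _ _ (@aff_rad_mx m) (@aff_rad_mx_is_linear m).

Definition aff_rad_space m : {vspace 'M[R]_(1 + m)} :=
  limg (linfun (@aff_rad_mx m)).

Lemma mem_aff_rad_space m (X : 'M[R]_(1 + m)) :
  reflect (exists (beta : 'cV[R]_m) (beta0 : R),
             X = block_mx 0 beta^T 0 beta0%:M) (X \in aff_rad_space m).
Proof.
apply: (iffP memv_imgP) => [[[b b0] _ ->]|[b [b0 ->]]].
  by exists b, b0; rewrite lfunE.
by exists (b, b0); rewrite ?memvf // lfunE.
Qed.

Definition aff_sl_mx m (A : 'M[R]_m) : 'M[R]_(1 + m) := block_mx 0 0 0 A.

Fact aff_sl_mx_is_linear m : linear (@aff_sl_mx m).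
Proof.
by move=> c x y; rewrite /aff_sl_mx scale_block_mx add_block_mx !scaler0 !addr0.
Qed.
HB.instance Definition _ m :=
  GRing.isLinear.Build R _ _ _ (@aff_sl_mx m) (@aff_sl_mx_is_linear m).

Definition aff_sl_space m : {vspace 'M[R]_(1 + m)} :=
  (linfun (@aff_sl_mx m) @: sl_space R m)%VS.

Lemma mem_aff_sl_space m (X : 'M[R]_(1 + m)) :
  reflect (exists2 A : 'M[R]_m, \tr A = 0 & X = block_mx 0 0 0 A)
          (X \in aff_sl_space m).
Proof.
apply: (iffP memv_imgP) => [[A]|[A trA ->]].
  by rewrite mem_sl_space lfunE => /eqP trA ->; exists A.
by exists A; rewrite ?mem_sl_space ?trA // lfunE.
Qed.

Definition outer n (a b : 'cV[R]_n) : 'M[R]_n := \matrix_(i, j) (a i 0 * b j 0).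

Definition is_orthonormal_basis n m (U : {vspace 'cV[R]_n})
    (v : 'I_m -> 'cV[R]_n) : Prop :=
  basis_of U [tuple v i | i < m] /\
  forall i j, \sum_k v i k 0 * v j k 0 = (i == j)%:R.

Definition v0 m : 'cV[R]_(1 + m) := (Num.sqrt (1 + m)%:R)^-1 *: const_mx 1.

Definition Zmx m : 'M[R]_(1 + m) :=
  (Num.sqrt m%:R)^-1 *: (1%:M - outer (v0 m) (v0 m)).

(* v i, for i < m, is the vector v_(i+1). *)
Section Basis.
Variables (m : nat) (v : 'I_m -> 'cV[R]_(1 + m)).

Definition Rmx (i : 'I_m) : 'M[R]_(1 + m) := outer (v0 m) (v i).

Definition A_space : {vspace 'M[R]_(1 + m)} :=
  <<[seq outer (v p.1) (v p.2)
      | p : 'I_m * 'I_m in [pred p | p.1 != p.2]]>>%VS.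

Definition H_mx (gamma : 'cV[R]_m) : 'M[R]_(1 + m) :=
  \sum_l gamma l 0 *: outer (v l) (v l).

Fact H_mx_is_linear : linear H_mx.
Proof.
move=> c x y; rewrite /H_mx scaler_sumr -big_split /=.
by apply: eq_bigr => i _; rewrite !mxE scalerDl scalerA.
Qed.
HB.instance Definition _ := GRing.isLinear.Build R _ _ _ H_mx H_mx_is_linear.

Definition H_space : {vspace 'M[R]_(1 + m)} :=
  (linfun H_mx @: hyperplane m)%VS.

Lemma mem_H_space (X : 'M[R]_(1 + m)) :
  reflect (exists2 gamma : 'cV[R]_m, \sum_l gamma l 0 = 0
             & X = \sum_l gamma l 0 *: outer (v l) (v l))
          (X \in H_space).
Proof.
apply: (iffP memv_imgP) => [[g]|[g sg ->]].
  by rewrite mem_hyperplane lfunE => /eqP sg ->; exists g.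
by exists g; rewrite ?mem_hyperplane ?sg // lfunE.
Qed.

(* The sum is direct when v is orthonormal, see l_space_direct. *)
Definition l_space : {vspace 'M[R]_(1 + m)} := (A_space + H_space)%VS.

Definition M1mx : 'M[R]_(1 + m, m) := \matrix_(i, j) v j i 0.

Definition Mmx : 'M[R]_(1 + m) := row_mx (v0 m) M1mx.

Lemma l_space_direct :
  is_orthonormal_basis (hyperplane (1 + m)) v -> directv (A_space + H_space).
Proof.
case=> _ orth.
have diagE k i j : ((v k)^T *m outer (v i) (v j) *m v k) 0 0
    = ((k == i) && (k == j))%:R.
  have -> : outer (v i) (v j) = v i *m (v j)^T.
    by apply/matrixP=> a b; rewrite !mxE big_ord1 !mxE.
  have dotE a b : (v a)^T *m v b = (a == b)%:R%:M.
    apply/matrixP=> x y; rewrite !ord1 mxE -orth mxE mulr1n.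
    by apply: eq_bigr => z _; rewrite mxE.
  rewrite mulmxA dotE -mulmxA dotE -scalar_mxM mxE mulr1n eq_sym [j == k]eq_sym.
  by rewrite -natrM mulnb eq_sym.
pose d k : 'M[R]_(1 + m) -> R^o := fun X => ((v k)^T *m X *m v k) 0 0.
have dL k : linear (d k).
  by move=> c X Y; rewrite /d mulmxDr mulmxDl -scalemxAr -scalemxAl !mxE.
pose dl k : {linear 'M[R]_(1 + m) -> R^o} :=
  HB.pack (d k) (GRing.isLinear.Build R _ _ _ (d k) (dL k)).
apply/directv_addP/eqP; rewrite -subv0; apply/subvP=> X.
rewrite memv_cap => /andP[XA /mem_H_space[g _ XE]].
have dA k : d k X = 0.
  have /subvP/(_ X XA) : (A_space <= lker (linfun (dl k)))%VS.
    apply/span_subvP=> _ /imageP[[i j] /= nij ->].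
    rewrite memv_ker (lfunE (dl k)) /= /d diagE.
    have -> : (k == i) && (k == j) = false; last by rewrite eqxx.
    by apply: contraNF nij => /andP[/eqP <-].
  by rewrite memv_ker (lfunE (dl k)) => /eqP.
suff g0 k : g k 0 = 0.
  by rewrite XE big1 ?mem0v // => k _; rewrite g0 scale0r.
have := dA k; rewrite XE -[d k]/(dl k : _ -> _) linear_sum (bigD1 k) // big1.
  by rewrite linearZ /= /d diagE eqxx addr0 /GRing.scale /= mulr1.
move=> l nl; rewrite linearZ /= /d diagE eq_sym (negbTE nl) /=.
by rewrite /GRing.scale /= mulr0.
Qed.

End Basis.

End Spaces.

(* Main.v *)
Require Import Defs.
From HB Require Import structures.
From mathcomp Require Import all_boot all_order all_algebra.
From mathcomp Require Import reals.

(* In an orthonormal basis starting with v0 the condition S 1 = 0 says that the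
   first column vanishes, which gives the isomorphism and the block formula.
   For the radical, an ideal I of the affine algebra contains with (B, A) also
   its part (0, A), by bracketing with (0, Id).  If A is not scalar, brackets
   with elementary matrices E_kl, k != l, produce from it a multiple of some
   E_kl and then a whole sl_2-triple, so I is not solvable.  These brackets stay
   inside sl, so the same argument shows that sl has no nonzero solvable ideal:
   a scalar matrix of trace 0 is 0 in characteristic 0. *)

Set Implicit Arguments.
Unset Strict Implicit.
Unset Printing Implicit Defensive.

Import Order.TTheory GRing.Theory Num.Theory.
Local Open Scope ring_scope.

(** * Brackets of elementary matrices and [sl_2]-triples *)

Section LieAlgebras.
Variable F : fieldType.

Lemma lie_brDl n (A B C : 'M[F]_n) : lie_br (A + B) C = lie_br A C + lie_br B C.
Proof. by rewrite /lie_br mulmxDl mulmxDr opprD addrACA. Qed.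

Lemma lie_brC n (A B : 'M[F]_n) : lie_br A B = - lie_br B A.
Proof. by rewrite /lie_br opprB. Qed.

Lemma lie_brZl n c (A B : 'M[F]_n) : lie_br (c *: A) B = c *: lie_br A B.
Proof. by rewrite /lie_br -scalemxAl -scalemxAr scalerBr. Qed.

Lemma lie_br0r n (A : 'M[F]_n) : lie_br A 0 = 0.
Proof. by rewrite /lie_br mulmx0 mul0mx subr0. Qed.

Lemma lie_br_scalar n (A : 'M[F]_n) a : lie_br A a%:M = 0.
Proof. by rewrite /lie_br scalar_mxC subrr. Qed.

Lemma mxtrace_lie_br n (A B : 'M[F]_n) : \tr (lie_br A B) = 0.
Proof. by rewrite /lie_br raddfB /= mxtrace_mulC subrr. Qed.

(* An sl_2-triple lies in every term of the derived series. *)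
Lemma sl2_triple_solvable n (L : {vspace 'M[F]_n}) (e f h : 'M[F]_n) :
  (2%:R : F) != 0 -> lie_br e f = h -> lie_br h e = 2%:R *: e ->
  lie_br h f = - (2%:R *: f) ->
  is_solvable L -> e \in L -> f \in L -> h \in L -> e = 0.
Proof.
move=> two0 ef he hf [k Lk] eL fL hL.
suff /and3P[eLk _ _] : [&& e \in derived_series k L, f \in derived_series k L
    & h \in derived_series k L] by apply/eqP; rewrite -memv0 -Lk.
elim: k {Lk} => [|k /and3P[eD fD hD]]; first exact/and3P.
have e2 : 2%:R *: e \in derived_series k.+1 L by rewrite -he memv_lie_prod.
have f2 : 2%:R *: f \in derived_series k.+1 L.
  by rewrite -[_ *: f]opprK -hf rpredN memv_lie_prod.
have hD' : h \in derived_series k.+1 L by rewrite -ef memv_lie_prod.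
move: e2 f2; rewrite !rpredZeq (negbTE two0) /= => -> ->; exact: hD'.
Qed.

Lemma lie_br_delta n (i j k l : 'I_n) :
  lie_br (delta_mx i j) (delta_mx k l) =
    delta_mx i l *+ (j == k) - delta_mx k j *+ (l == i) :> 'M[F]_n.
Proof. by rewrite /lie_br !mul_delta_mx_cond. Qed.

(** As [E = E_lk] squares to 0, the double bracket is [-2 E A E], and [E A E] picks out the single
    entry [A k l]. *)
Lemma lie_br_delta_delta n (A : 'M[F]_n) (k l : 'I_n) : k != l ->
  lie_br (delta_mx l k) (lie_br (delta_mx l k) A) =
    - (2%:R * A k l) *: delta_mx l k.
Proof.
move=> nkl; set E := delta_mx l k.
have EE : E *m E = 0 by rewrite mul_delta_mx_0.
have EAE : E *m A *m E = A k l *: E.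
  have -> : E = delta_mx l (0 : 'I_1) *m delta_mx 0 k by rewrite mul_delta_mx.
  rewrite -!mulmxA (mulmxA A) -colE (mulmxA (delta_mx 0 k)) -rowE.
  by rewrite [row k _]mx11_scalar !mxE mul_scalar_mx scalemxAr.
rewrite /lie_br mulmxBr mulmxBl !mulmxA EE mul0mx EAE -(mulmxA A) EE mulmx0.
by rewrite sub0r subr0 -opprD -mulr2n scaleNr -scalerA scaler_nat.
Qed.

(** Elementary matrices are eigenvectors of bracketing with a diagonal matrix, so two unequal
    diagonal entries of [A] yield [E_kl] itself. *)
Lemma lie_br_delta_diag n (A : 'M[F]_n) (k l : 'I_n) : is_diag_mx A ->
  lie_br (delta_mx k l) A = (A l l - A k k) *: delta_mx k l.
Proof.
move=> /diag_mxP[d ->]; rewrite /lie_br mul_mx_diag mul_diag_mx.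
apply/matrixP=> i j; rewrite !mxE !eqxx !mulr1n.
have [-> | _] := eqVneq i k; last by rewrite !(mulr0, mul0r) subr0.
have [-> | _] := eqVneq j l; last by rewrite !(mulr0, mul0r) subr0.
by rewrite !mulr1 mul1r.
Qed.

End LieAlgebras.

(** * Brackets in block form and solvable stable subspaces *)

Section AffineAlgebra.
Variables (R : realType) (m : nat).
Implicit Types (A C : 'M[R]_m) (B D : 'rV[R]_m).

Lemma lie_br_aff B A D C :
  lie_br (block_mx 0 B 0 A) (block_mx 0 D 0 C) =
    block_mx (0 : 'M_1) (B *m C - D *m A) (0 : 'cV_m) (lie_br A C).
Proof.
rewrite /lie_br !mulmx_block !(mulmx0, mul0mx, add0r, addr0).
by rewrite opp_block_mx add_block_mx !subr0.
Qed.

Lemma lie_br_aff_sl_mx A C :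
  lie_br (aff_sl_mx A) (aff_sl_mx C) = aff_sl_mx (lie_br A C).
Proof. by rewrite lie_br_aff !mul0mx subrr. Qed.

Lemma aff_sl_mx_inj : injective (@aff_sl_mx R m).
Proof. by move=> A C /eq_block_mx[]. Qed.

Section SolvableIdeal.
Variable I : {vspace 'M[R]_(1 + m)}.
Hypothesis solI : is_solvable I.
(** Weaker than being an ideal: the [E_kl] with [k != l] are traceless, so this covers ideals of the
    affine algebra and of its [sl] part alike. *)
Hypothesis stabI : forall (k l : 'I_m) A, k != l ->
  aff_sl_mx A \in I -> aff_sl_mx (lie_br (delta_mx k l) A) \in I.

(** Bracketing [E_kl] twice with [E_lk] gives [-2 E_lk], and one more bracket with [E_kl] completes
    an [sl_2]-triple inside [I]. *)
Lemma solvable_notin_delta (k l : 'I_m) :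
  k != l -> aff_sl_mx (delta_mx k l) \notin I.
Proof.
move=> nkl; have nlk : l != k by rewrite eq_sym.
apply/negP=> eI.
pose e := delta_mx k l : 'M[R]_m; pose f := delta_mx l k : 'M[R]_m.
have ef : lie_br e f = delta_mx k k - delta_mx l l.
  by rewrite lie_br_delta !eqxx !mulr1n.
have fI : aff_sl_mx f \in I.
  have := stabI nlk (stabI nlk eI); rewrite lie_br_delta_delta //.
  rewrite linearZ /= rpredZeq oppr_eq0 mulf_eq0 pnatr_eq0 /= => /orP[|//].
  by rewrite mxE !eqxx oner_eq0.
have he : lie_br (lie_br e f) e = 2%:R *: e.
  rewrite ef lie_brDl -scaleN1r lie_brZl !lie_br_delta !eqxx.
  rewrite (negbTE nlk) scaleN1r !mulr0n !mulr1n subr0 sub0r opprK.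
  by rewrite scaler_nat.
have hf : lie_br (lie_br e f) f = - (2%:R *: f).
  rewrite ef lie_brDl -scaleN1r lie_brZl !lie_br_delta !eqxx.
  rewrite (negbTE nkl) scaleN1r !mulr0n !mulr1n subr0 sub0r.
  by rewrite -opprD scaler_nat.
have hI := stabI nkl fI.
suff /(@aff_sl_mx_inj _ 0)/matrixP/(_ k l)/eqP : aff_sl_mx e = aff_sl_mx 0.
  by rewrite !mxE !eqxx oner_eq0.
rewrite linear0; apply: sl2_triple_solvable (lie_br_aff_sl_mx e f) _ _ solI eI fI hI.
- by rewrite pnatr_eq0.
- by rewrite lie_br_aff_sl_mx he linearZ.
- by rewrite lie_br_aff_sl_mx hf linearN linearZ.
Qed.

(** A nonzero off-diagonal entry, or else two distinct diagonal entries, would put some elementary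
    matrix into [I]. *)
Lemma solvable_scalar A : aff_sl_mx A \in I -> exists a, A = a%:M.
Proof.
move=> AI; have diagA : is_diag_mx A.
  apply/is_diag_mxP=> k l nkl; apply/eqP/negPn/negP=> Akl.
  have nlk : l != k by rewrite eq_sym.
  have := stabI nlk (stabI nlk AI); rewrite lie_br_delta_delta // linearZ /=.
  rewrite rpredZeq oppr_eq0 mulf_eq0 pnatr_eq0 (negbTE Akl) /=.
  exact/negP/solvable_notin_delta.
have eqA k l : A k k = A l l.
  have [-> // | nkl] := eqVneq k l; apply/eqP; rewrite eq_sym -subr_eq0.
  have := stabI nkl AI; rewrite lie_br_delta_diag // linearZ /= rpredZeq.
  by rewrite (negbTE (solvable_notin_delta nkl)) orbF.
(* For [m = 0] there is no diagonal entry to read the scalar from; 0 serves as a default. *)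
case: (pickP (@predT 'I_m)) => [i _ | none]; last first.
  by exists 0; apply/matrixP=> k; have := none k.
exists (A i i); apply/matrixP=> k l; rewrite mxE.
have [-> | nkl] := eqVneq k l; first exact: eqA.
by rewrite (is_diag_mxP diagA).
Qed.

End SolvableIdeal.

(** * Radical and Levi subalgebra of the affine algebra *)

Lemma delta_mx_tr0 (k l : 'I_m) :
  k != l -> \tr (delta_mx k l : 'M[R]_m) = 0.
Proof.
move=> nkl; rewrite /mxtrace big1 // => i _; rewrite mxE.
by have [-> | //] := eqVneq i k; rewrite (negbTE nkl).
Qed.

Lemma aff_space_lie_algebra : is_lie_algebra (aff_space R m).
Proof.
move=> _ _ /mem_aff_space[B [A ->]] /mem_aff_space[D [C ->]].
by rewrite lie_br_aff; apply/mem_aff_space; do 2!eexists.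
Qed.

Lemma lie_ideal_aff_rad : is_lie_ideal (aff_rad_space R m) (aff_space R m).
Proof.
split=> [|_ _ /mem_aff_space[B [A ->]] /mem_aff_rad_space[b [b0 ->]]].
  apply/subvP=> _ /mem_aff_rad_space[b [b0 ->]].
  by apply/mem_aff_space; do 2!eexists.
rewrite lie_br_aff; apply/mem_aff_rad_space.
(* Scalar blocks are central, so only a translation part remains. *)
exists (B *m b0%:M - b^T *m A)^T, 0; rewrite trmxK.
by rewrite lie_br_scalar raddf0.
Qed.

(* The commutator algebra of the radical consists of the translations. *)
Lemma solvable_aff_rad : is_solvable (aff_rad_space R m).
Proof.
(* The translations, cut out by the vanishing of the lower [m] rows. *)
pose T := (aff_space R m :&: lker (linfun (@dsubmx R 1 m (1 + m))))%VS.
have memT D : block_mx 0 D 0 0 \in T.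
  rewrite memv_cap memv_ker lfunE /= col_mxKd row_mx0 eqxx andbT.
  by apply/mem_aff_space; exists D, 0.
have T_abelian : (lie_prod T T <= 0)%VS.
  apply/lie_prodP=> X Y.
  rewrite !memv_cap => /andP[/mem_aff_space[B [A ->]]].
  rewrite memv_ker lfunE /= col_mxKd row_mx_eq0 => /andP[_ /eqP->].
  case/andP=> /mem_aff_space[D [C ->]].
  rewrite memv_ker lfunE /= col_mxKd row_mx_eq0 => /andP[_ /eqP->].
  by rewrite lie_br_aff !mulmx0 subrr lie_br0r block_mx0 mem0v.
have sDT : (lie_prod (aff_rad_space R m) (aff_rad_space R m) <= T)%VS.
  apply/lie_prodP=> _ _ /mem_aff_rad_space[b [b0 ->]] /mem_aff_rad_space[c [c0 ->]].
  by rewrite lie_br_aff lie_br_scalar.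
exists 2%N; apply/eqP; rewrite /= -subv0; apply/lie_prodP=> X Y XD YD.
by apply: (lie_prodP _ _ _ T_abelian); apply: (subvP sDT).
Qed.

Lemma radical_aff : is_radical (aff_rad_space R m) (aff_space R m).
Proof.
split; [exact: lie_ideal_aff_rad | exact: solvable_aff_rad |].
move=> I [sIL idI] solI; apply/subvP=> X XI.
have /mem_aff_space[B [A XE]] := subvP sIL X XI; rewrite {}XE in XI *.
have slL C : aff_sl_mx C \in aff_space R m by apply/mem_aff_space; exists 0, C.
have AI : aff_sl_mx A \in I.
  (* The bracket of [(0, Id)] with [(B, A)] is [(-B, 0)]; adding it to [(B, A)] leaves [(0, A)]. *)
  have := idI _ _ (slL 1%:M) XI; rewrite lie_br_aff mul0mx mulmx1 sub0r => trI.
  have := memvD trI XI; rewrite add_block_mx !addr0 addNr.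
  by rewrite lie_brC lie_br_scalar oppr0 add0r.
have [|a ->] := @solvable_scalar I solI _ A AI.
  by move=> k l C _ CI; rewrite -lie_br_aff_sl_mx; apply: idI.
by apply/mem_aff_rad_space; exists B^T, a; rewrite trmxK.
Qed.

Lemma lie_subalgebra_aff_sl :
  is_lie_subalgebra (aff_sl_space R m) (aff_space R m).
Proof.
split.
  apply/subvP=> _ /mem_aff_sl_space[A _ ->].
  by apply/mem_aff_space; exists 0, A.
move=> _ _ /mem_aff_sl_space[A _ ->] /mem_aff_sl_space[C _ ->].
rewrite lie_br_aff_sl_mx; apply/mem_aff_sl_space.
by exists (lie_br A C); rewrite ?mxtrace_lie_br.
Qed.

(** The conclusion concerns the matrix and not [a], so that it stays true for [m = 0]. *)
Lemma tr_scalar_eq0 (a : R) : \tr (a%:M : 'M_m) = 0 -> a%:M = 0 :> 'M[R]_m.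
Proof.
rewrite mxtrace_scalar; case: m => [|p]; first by rewrite [_%:M]flatmx0 => _.
by move/eqP; rewrite mulrn_eq0 /= => /eqP ->; rewrite raddf0.
Qed.

Lemma semisimple_aff_sl : is_semisimple (aff_sl_space R m).
Proof.
have [_ algK] := lie_subalgebra_aff_sl; split=> //; split.
- split; first exact: sub0v.
  by move=> X Y _; rewrite memv0 => /eqP->; rewrite lie_br0r mem0v.
- by exists 0%N.
move=> I [sIK idI] solI; apply/subvP=> X XI.
have /mem_aff_sl_space[A trA XE] := subvP sIK X XI; rewrite {}XE in XI *.
have [|a aE] := @solvable_scalar I solI _ A XI.
  move=> k l C nkl CI; rewrite -lie_br_aff_sl_mx; apply: idI => //.
  by apply/mem_aff_sl_space; exists (delta_mx k l); rewrite ?delta_mx_tr0.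
by rewrite aE tr_scalar_eq0 -?aE // block_mx0 mem0v.
Qed.

Lemma levi_aff_sl : (0 < m)%N ->
  is_levi_subalgebra (aff_sl_space R m) (aff_space R m).
Proof.
move=> m_gt0; have subK := lie_subalgebra_aff_sl.
split; [exact: subK | exact: semisimple_aff_sl |].
exists (aff_rad_space R m); first exact: radical_aff.
split; apply/eqP.
  rewrite eqEsubv subv_add; case: subK => [-> _] /=.
  have [[-> _] _ _] := radical_aff; apply/subvP=> _ /mem_aff_space[B [A ->]].
  (* Chosen so that [A - c%:M] is traceless; [0 < m] makes the division meaningful. *)
  pose c := \tr A / m%:R.
  have -> : block_mx 0 B 0 A = aff_sl_mx (A - c%:M) + block_mx 0 B 0 c%:M.
    by rewrite add_block_mx !add0r subrK.
  rewrite memv_add //; last by apply/mem_aff_rad_space; exists B^T, c; rewrite trmxK.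
  apply/mem_aff_sl_space; exists (A - c%:M) => //.
  by rewrite raddfB /= mxtrace_scalar -mulr_natr divfK ?subrr // pnatr_eq0 -lt0n.
rewrite -subv0; apply/subvP=> X; rewrite memv_cap => /andP[].
case/mem_aff_sl_space=> A trA -> /mem_aff_rad_space[b [b0]].
case/eq_block_mx=> _ _ _ AE; rewrite AE tr_scalar_eq0 -?AE //.
by rewrite memv0 block_mx0.
Qed.

End AffineAlgebra.

(** * Conjugation by the orthogonal matrix [M] *)

Section Conjugation.
Variables (R : realType) (m : nat) (v : 'I_m -> 'cV[R]_(1 + m)).
Hypothesis hv : is_orthonormal_basis (hyperplane R (1 + m)) v.

Local Notation v0 := (v0 R m).
Local Notation M := (Mmx v).
Local Notation M1 := (M1mx v).
Local Notation ones := (const_mx 1 : 'cV[R]_(1 + m)).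

Lemma outerE n (a b : 'cV[R]_n) : outer a b = a *m b^T.
Proof. by apply/matrixP=> i j; rewrite !mxE big_ord1 !mxE. Qed.

Lemma sqrt_dim_gt0 : 0 < Num.sqrt (1 + m)%:R :> R.
Proof. by rewrite sqrtr_gt0 ltr0n. Qed.

Lemma ones_v0 : ones = Num.sqrt (1 + m)%:R *: v0.
Proof. by rewrite scalerA divff ?scale1r // gt_eqF // sqrt_dim_gt0. Qed.

Lemma v0_v0 : v0^T *m v0 = 1%:M.
Proof.
apply/matrixP=> i j; rewrite !ord1 !mxE.
under eq_bigr do rewrite !mxE mulr1.
rewrite sumr_const card_ord -expr2 exprVn sqr_sqrtr ?ler0n // -[X in X = _]mulr_natr.
by rewrite mulVf ?pnatr_eq0.
Qed.

Lemma M1_M1 : M1^T *m M1 = 1%:M.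
Proof.
case: hv => _ orth; apply/matrixP=> i j; rewrite !mxE -orth.
by apply: eq_bigr => k _; rewrite !mxE.
Qed.

(** The coordinates of each [v j] sum to 0, and [v0] is a multiple of the all-ones vector. *)
Lemma v0_M1 : v0^T *m M1 = 0.
Proof.
apply/matrixP=> i j; rewrite !mxE.
under eq_bigr do rewrite !mxE mulr1.
have : v j \in hyperplane R (1 + m).
  case: hv => /andP[/eqP <- _] _; apply/memv_span/tnthP; exists j.
  by rewrite tnth_mktuple.
by rewrite -mulr_sumr mem_hyperplane => /eqP->; rewrite mulr0.
Qed.

Lemma M1_v0 : M1^T *m v0 = 0.
Proof. by apply: trmx_inj; rewrite trmx_mul trmxK v0_M1 trmx0. Qed.

Lemma conj_block (S : 'M[R]_(1 + m)) :
  M^T *m S *m M =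
    block_mx (v0^T *m S *m v0) (v0^T *m S *m M1)
             (M1^T *m S *m v0) (M1^T *m S *m M1).
Proof. by rewrite /Mmx tr_row_mx mul_col_mx mul_col_row. Qed.

Lemma trM_M : M^T *m M = 1%:M.
Proof.
rewrite /Mmx tr_row_mx mul_col_row v0_v0 v0_M1 M1_v0 M1_M1.
by rewrite -scalar_mx_block.
Qed.

Lemma M_trM : M *m M^T = 1%:M.
Proof. exact: mulmx1C trM_M. Qed.

(** Completeness of the orthonormal basis: split [M *m M^T = 1%:M] after the first column. It makes
    [Zmx] a multiple of [M1 *m M1^T]. *)
Lemma M1_trM1 : M1 *m M1^T = 1%:M - v0 *m v0^T.
Proof. by rewrite -M_trM /Mmx tr_row_mx mul_row_col addrC addKr. Qed.

Lemma mem_s_space_v0 S : (S \in s_space R (1 + m)) = (S *m v0 == 0).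
Proof.
rewrite mem_s_space ones_v0 -scalemxAr scaler_eq0 gt_eqF //; exact: sqrt_dim_gt0.
Qed.

Lemma s_space_lie_algebra : is_lie_algebra (s_space R (1 + m)).
Proof.
move=> A C; rewrite !mem_s_space => /eqP A0 /eqP C0.
by rewrite mulmxBl -!mulmxA A0 C0 !mulmx0 subrr.
Qed.

Lemma conj_in_aff S : S \in s_space R (1 + m) ->
  M^T *m S *m M \in aff_space R m.
Proof.
rewrite mem_s_space_v0 => /eqP Sv0; rewrite conj_block -!(mulmxA _ S v0) Sv0.
by rewrite !mulmx0; apply/mem_aff_space; do 2!eexists.
Qed.

Lemma conjK S : M *m (M^T *m S *m M) *m M^T = S.
Proof. by rewrite !mulmxA M_trM mul1mx -mulmxA M_trM mulmx1. Qed.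

Lemma conjVK X : M^T *m (M *m X *m M^T) *m M = X.
Proof. by rewrite !mulmxA trM_M mul1mx -mulmxA trM_M mulmx1. Qed.

Lemma conjV_block B C :
  M *m block_mx 0 B 0 C *m M^T = v0 *m B *m M1^T + M1 *m C *m M1^T.
Proof.
rewrite /Mmx tr_row_mx mul_row_block !mulmx0 !addr0 mul_row_col mul0mx add0r.
by rewrite mulmxDl.
Qed.

Lemma conj_lie_isomorphism :
  is_lie_isomorphism (s_space R (1 + m)) (aff_space R m)
    (fun S => M^T *m S *m M).
Proof.
split.
- by split; [exact: s_space_lie_algebra | exact: aff_space_lie_algebra].
- exact: conj_in_aff.
- by move=> c A C _ _; rewrite mulmxDr mulmxDl -scalemxAr -scalemxAl.
- move=> A C _ _; rewrite /lie_br mulmxBr mulmxBl !mulmxA.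
  by rewrite -!(mulmxA _ M) M_trM !mulmx1.
split=> [A C _ _ /(congr1 (fun X => M *m X *m M^T))|]; first by rewrite !conjK.
move=> _ /mem_aff_space[B [C ->]].
(* The inverse conjugation; its value kills [v0] because [M1^T *m v0 = 0]. *)
exists (M *m block_mx 0 B 0 C *m M^T); last exact: conjVK.
by rewrite mem_s_space_v0 conjV_block mulmxDl -!mulmxA M1_v0 !mulmx0 addr0.
Qed.

(** * The decomposition along [Zmx], [Rmx] and [l_space] *)

Lemma M1_outer_sum (C : 'M[R]_m) :
  M1 *m C *m M1^T = \sum_i \sum_j C i j *: outer (v i) (v j).
Proof.
apply/matrixP=> a b; rewrite mxE summxE.
under [RHS]eq_bigr do rewrite summxE.
rewrite exchange_big; apply: eq_bigr => j _ /=.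
rewrite !mxE mulr_suml; apply: eq_bigr => i _.
by rewrite !mxE mulrAC mulrC.
Qed.

(** Off-diagonal entries of [C] are coefficients in [A_space]; the diagonal ones sum to the trace 0
    and give an element of [H_space]. *)
Lemma M1_in_l_space (C : 'M[R]_m) : \tr C = 0 -> M1 *m C *m M1^T \in l_space v.
Proof.
move=> trC; rewrite M1_outer_sum.
have -> : \sum_i \sum_j C i j *: outer (v i) (v j) =
    \sum_i \sum_(j | i != j) C i j *: outer (v i) (v j) +
    \sum_i C i i *: outer (v i) (v i).
  rewrite -big_split; apply: eq_bigr => i _ /=.
  by rewrite (bigD1 i) //= addrC; congr (_ + _); apply: eq_bigl => j; rewrite eq_sym.
apply: memv_add.
  apply: memv_suml => i _; apply: memv_suml => j nij; apply/memvZ/memv_span.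
  by apply/imageP; exists (i, j).
apply/mem_H_space; exists (\col_i C i i).
  by rewrite -[RHS]trC; apply: eq_bigr => i _; rewrite mxE.
by apply: eq_bigr => i _; rewrite mxE.
Qed.

Lemma M1_col j : v j = M1 *m delta_mx j 0.
Proof. by rewrite -colE; apply/matrixP=> a b; rewrite !mxE ord1. Qed.

Lemma v0_v j : v0^T *m v j = 0.
Proof. by rewrite M1_col mulmxA v0_M1 mul0mx. Qed.

Lemma v_v0 j : (v j)^T *m v0 = 0.
Proof. by apply: trmx_inj; rewrite trmx_mul trmxK v0_v trmx0. Qed.

(** Each [outer (v i) (v j)] is annihilated by [v0] on both sides, and these products span a space
    containing [l_space v]. *)
Lemma l_space_v0 A : A \in l_space v -> v0^T *m A = 0 /\ A *m v0 = 0.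
Proof.
pose K := (lker (linfun (mulmx v0^T)) :&: lker (linfun (mulmxr v0)))%VS :
  {vspace 'M[R]_(1 + m)}.
have outK i j : outer (v i) (v j) \in K.
  rewrite memv_cap !memv_ker !lfunE /= outerE mulmxA v0_v mul0mx.
  by rewrite -mulmxA v_v0 mulmx0 !eqxx.
have sK : (l_space v <= K)%VS.
  rewrite subv_add; apply/andP; split.
    by apply/span_subvP=> _ /imageP[[i j] _ ->].
  apply/subvP=> _ /mem_H_space[g _ ->]; apply: memv_suml => i _.
  exact: memvZ.
move=> /(subvP sK); rewrite memv_cap !memv_ker !lfunE /=.
by case/andP=> /eqP-> /eqP->.
Qed.

Lemma sum_Rmx (beta : 'cV[R]_m) :
  \sum_i beta i 0 *: Rmx v i = v0 *m beta^T *m M1^T.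
Proof.
rewrite -mulmxA -trmx_mul.
have -> : M1 *m beta = \sum_i beta i 0 *: v i.
  apply/matrixP=> a b; rewrite !ord1 mxE summxE.
  by apply: eq_bigr => i _; rewrite !mxE mulrC.
rewrite linear_sum mulmx_sumr; apply: eq_bigr => i _.
by rewrite linearZ /= -scalemxAr -outerE.
Qed.

Lemma Zmx_M1 : Zmx R m = (Num.sqrt m%:R)^-1 *: (M1 *m M1^T).
Proof. by rewrite /Zmx M1_trM1 outerE. Qed.

Lemma s_space_decomposition S : (0 < m)%N -> S \in s_space R (1 + m) ->
  exists (beta0 : R) (beta : 'cV[R]_m) (A : 'M[R]_(1 + m)),
    A \in l_space v /\
    S = beta0 *: Zmx R m + \sum_i beta i 0 *: Rmx v i + A.
Proof.
move=> m_gt0 /conj_in_aff/mem_aff_space[B [C SE]]; pose c := \tr C / m%:R.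
(* The block [C] splits into traceless and scalar parts; the factor [Num.sqrt m%:R] undoes the
   normalisation of [Zmx]. *)
exists (c * Num.sqrt m%:R), B^T, (M1 *m (C - c%:M) *m M1^T); split.
  apply: M1_in_l_space; rewrite raddfB /= mxtrace_scalar -mulr_natr divfK ?subrr //.
  by rewrite pnatr_eq0 -lt0n.
rewrite -[LHS]conjK SE conjV_block sum_Rmx trmxK Zmx_M1 scalerA mulfK; last first.
  by rewrite gt_eqF // sqrtr_gt0 ltr0n.
rewrite [c *: _ + _]addrC -addrA; congr (_ + _).
rewrite mulmxBr mulmxBl.
by rewrite mul_mx_scalar -scalemxAl addrC subrK.
Qed.

(** By orthonormality the [Rmx] terms reach only the upper right block, while [Zmx] and [A] reach
    only the lower right one. *)
Lemma conj_decomposition (beta0 : R) (beta : 'cV[R]_m) A :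
  A \in l_space v ->
  M^T *m (beta0 *: Zmx R m + \sum_i beta i 0 *: Rmx v i + A) *m M =
    block_mx 0 beta^T 0 (M1^T *m A *m M1 + (beta0 / Num.sqrt m%:R)%:M).
Proof.
move=> /l_space_v0[]; rewrite sum_Rmx Zmx_M1 scalerA conj_block.
(* Unification would see through v0, a scalar multiple, in scalemxAr. *)
move: v0_v0 v0_M1 M1_v0; move: v0 => w ww wM1 M1w wA Aw.
rewrite !mulmxDr !mulmxDl -!scalemxAr -!scalemxAl !mulmxA.
rewrite wA wM1 M1w M1_M1 ww !(mul0mx, mul1mx) -!mulmxA Aw M1w M1_M1.
by rewrite !(mulmx0, mulmx1, scaler0, add0r, addr0) scalemx1 addrC.
Qed.

End Conjugation.

Theorem mainTheorem4 (R : realType) (m : nat) (hn : (2 <= 1 + m)%N)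
    (v : 'I_m -> 'cV[R]_(1 + m))
    (hv : is_orthonormal_basis (hyperplane R (1 + m)) v) :
  [/\ is_lie_isomorphism (s_space R (1 + m)) (aff_space R m)
        (fun S => (Mmx v)^T *m S *m Mmx v),
      (forall S, S \in s_space R (1 + m) ->
        (exists (beta0 : R) (beta : 'cV[R]_m) (A : 'M[R]_(1 + m)),
           A \in l_space v /\
           S = beta0 *: Zmx R m + \sum_i beta i 0 *: Rmx v i + A) /\
        (forall (beta0 : R) (beta : 'cV[R]_m) (A : 'M[R]_(1 + m)),
           A \in l_space v ->
           S = beta0 *: Zmx R m + \sum_i beta i 0 *: Rmx v i + A ->
           (Mmx v)^T *m S *m Mmx v =
             block_mx 0 beta^T
                      0 ((M1mx v)^T *m A *m M1mx v
                         + (beta0 / Num.sqrt m%:R)%:M))),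
      is_radical (aff_rad_space R m) (aff_space R m)
    & is_levi_subalgebra (aff_sl_space R m) (aff_space R m)].
Proof.
have m_gt0 : (0 < m)%N by [].
split; [exact: conj_lie_isomorphism | | exact: radical_aff | exact: levi_aff_sl].
move=> S SL; split; first exact: s_space_decomposition.
by move=> beta0 beta A AL ->; apply: conj_decomposition.
Qed.
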